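(* Let $G=(V,E)$ be a finite simple graph, let $S\subset V$, and let $N_G(S)=(V_S,E_S)$ be the neighbor graph of $S$. Assume that the induced subgraph $\langle S\rangle$ is bipartite. Then a vector $x\in\mathbb{R}^{E_S}$ lies in the $S$-matching polytope $P_S$ if and only if (1) $x_e\ge0$ for all $e\in E_S$, and (2) $\sum_{e\ni v}x_e=1$ for all $v\in S$ (the sum over edges of $E_S$ incident to $v$).
   Context: For $S\subset V$, $S'=V\setminus S$; $\langle S\rangle$ is the induced subgraph on $S$. $\Gamma(S)=\{x\in S'\mid (x,y)\in E\text{ for some }y\in S\}$, $V_S=S\cup\Gamma(S)$, and $E_S$ is the set of edges of $G$ having at least one endpoint in $S$; $N_G(S)=(V_S,E_S)$. An $S$-matching is a set $M\subset E_S$ such that no two distinct edges of $M$ share a vertex of $S$ and every vertex of $S$ lies on some edge of $M$. The $S$-matching polytope is $P_S=\mathrm{conv}\{\chi_M\in\mathbb{R}^{E_S}\mid M\text{ an }S\text{-matching}\}$, where $(\chi_M)_e=1$ if $e\in M$ and $0$ otherwise. *)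

(* Defs.v *)
From HB Require Import structures.
From mathcomp Require Import all_boot all_order all_algebra.
From mathcomp Require Import classical_sets reals.

Set Implicit Arguments.
Unset Strict Implicit.
Unset Printing Implicit Defensive.

Import Order.TTheory GRing.Theory Num.Theory.
Local Open Scope ring_scope.

Record sgraph := SGraph {
  vertex :> finType;
  adj : rel vertex;
  adj_sym : symmetric adj;
  adj_irrefl : irreflexive adj }.

Definition edges (G : sgraph) : {set {set G}} :=
  [set [set p.1; p.2] | p in [set p : G * G | adj p.1 p.2]].

Section Induced.
Variables (G : sgraph) (S : {set G}).

Definition induced_adj : rel {x : G | x \in S} :=
  fun x y => adj (val x) (val y).

Lemma induced_adj_sym : symmetric induced_adj.
Proof. by move=> x y; apply: adj_sym. Qed.

Lemma induced_adj_irrefl : irreflexive induced_adj.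
Proof. by move=> x; apply: adj_irrefl. Qed.

Definition induced : sgraph := SGraph induced_adj_sym induced_adj_irrefl.

End Induced.

(* A and its complement are the two parts, possibly empty *)
Definition bipartite (G : sgraph) : Prop :=
  exists A : {set G}, forall x y : G, adj x y -> (x \in A) != (y \in A).

(* the edge set E_S of the neighbor graph N_G(S) *)
Definition nedges (G : sgraph) (S : {set G}) : {set {set G}} :=
  [set e in edges G | [exists v in S, v \in e]].

Definition S_matching (G : sgraph) (S : {set G}) (M : {set {set G}}) : Prop :=
  [/\ M \subset nedges S,
      forall e f, e \in M -> f \in M -> e != f ->
        forall v, v \in S -> ~ (v \in e /\ v \in f)
    & forall v, v \in S -> exists2 e, e \in M & v \in e].

(* R^(E_S); the regular module R^o makes it an lmodType R *)
Definition edge_space (R : realType) (G : sgraph) (S : {set G}) :=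
  {ffun {e : {set G} | e \in nedges S} -> R^o}.

Definition convex_hull (R : realType) (V : lmodType R) (A : set V) : set V :=
  fun x => exists (n : nat) (a : 'I_n -> R) (p : 'I_n -> V),
    [/\ forall i, 0 <= a i, \sum_(i < n) a i = 1, forall i, A (p i)
      & x = \sum_(i < n) a i *: p i].

Definition chi (R : realType) (G : sgraph) (S : {set G}) (M : {set {set G}}) :
    edge_space R S :=
  [ffun e => (val e \in M)%:R].

Definition S_matching_polytope (R : realType) (G : sgraph) (S : {set G}) :
    set (edge_space R S) :=
  convex_hull
    (fun y : edge_space R S => exists2 M, S_matching S M & y = chi R S M).

(* Main.v *)
(** A point of the polytope cut out by (1) and (2) that is not a 0/1 vector is a
    proper convex combination of two points of that polytope with strictly smaller
    support, so induction on the support writes every point as a convex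
    combination of 0/1 points, which are exactly the vectors [chi M].

    To split [x], let [F] be the set of edges with [0 < x e < 1] and [T] the set
    of vertices of [S] they cover.  By (2) every vertex of [T] lies on at least two
    edges of [F], while an edge meets [T] at most twice; hence [#|T| <= #|F|].  If
    [#|T| < #|F|], the incidence matrix of [F] against [T] has a nonzero left
    kernel for dimension reasons.  If [#|T| = #|F|], every edge of [F] has both
    endpoints in [T], so the signed colouring of the bipartite graph is in the
    right kernel, and the square incidence matrix is singular.  Either way there is
    a nonzero [d] supported on [F] with zero sum at each vertex of [S]; one moves
    from [x] along [d] and [- d] until a coordinate vanishes. *)

Require Import Defs.
From mathcomp Require Import all_boot all_order all_algebra.
From mathcomp Require Import classical_sets reals.
From mathcomp Require Import ring lra.

Set Implicit Arguments.
Unset Strict Implicit.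
Unset Printing Implicit Defensive.

Import Order.TTheory GRing.Theory Num.Theory.
Local Open Scope ring_scope.

(** * Convex hulls *)

Lemma convex_hull_incl (R : realType) (V : lmodType R) (A : set V) (x : V) :
  A x -> convex_hull A x.
Proof.
move=> Ax; exists 1%N, (fun=> 1), (fun=> x); split=> //.
- by rewrite big_ord1.
- by rewrite big_ord1 scale1r.
Qed.

Lemma convex_hull_conv (R : realType) (V : lmodType R) (A : set V) (x y : V)
    (s t : R) :
  0 <= s -> 0 <= t -> s + t = 1 -> convex_hull A x -> convex_hull A y ->
  convex_hull A (s *: x + t *: y).
Proof.
move=> s0 t0 st1 [m [a [p [a0 a1 Ap ->]]]] [n [b [q [b0 b1 Aq ->]]]].
exists (m + n)%N,
  (fun i => match split i with inl j => s * a j | inr j => t * b j end),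
  (fun i => match split i with inl j => p j | inr j => q j end).
have splitl (j : 'I_m) : split (lshift n j) = inl j by exact: (unsplitK (inl j)).
have splitr (j : 'I_n) : split (rshift m j) = inr j by exact: (unsplitK (inr j)).
split.
- by move=> i; case: (split i) => j; apply: mulr_ge0.
- rewrite big_split_ord /=.
  under eq_bigr do rewrite splitl.
  under [X in _ + X]eq_bigr do rewrite splitr.
  by rewrite -!mulr_sumr a1 b1 !mulr1.
- by move=> i; case: (split i).
- rewrite big_split_ord /= !scaler_sumr.
  by congr (_ + _); apply: eq_bigr => j _; rewrite ?splitl ?splitr scalerA.
Qed.

(** * Left kernel of an incidence matrix *)

Lemma left_kernel_vector (K : fieldType) (E V : finType) (a : E -> V -> K)
    (F : {set E}) (T : {set V}) :
  (#|T| <= #|F|)%N ->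
  (#|T| = #|F| -> exists w : V -> K,
     (exists2 v, v \in T & w v != 0) /\
     (forall e, e \in F -> \sum_(v in T) a e v * w v = 0)) ->
  exists d : E -> K, [/\ exists e, d e != 0, forall e, e \notin F -> d e = 0
    & forall v, v \in T -> \sum_e d e * a e v = 0].
Proof.
move=> leTF eqTF.
pose N : 'M[K]_(#|F|, #|T|) := \matrix_(i, j) a (enum_val i) (enum_val j).
have rkN : (\rank N < #|F|)%N.
  have := rank_leq_col N; rewrite leq_eqVlt => /predU1P[rkT|]; last first.
    by move=> /leq_trans; apply.
  (* Only full column rank with as many rows as columns remains; [N] is then injective on column
     vectors, which the right kernel vector [w] contradicts. *)
  move: leTF; rewrite leq_eqVlt -{2}rkT => /predU1P[TF|//].
  have [w [[v0 v0T wv0] Nw]] := eqTF TF.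
  pose W : 'cV[K]_#|T| := \col_j w (enum_val j).
  have NW0 : N *m W = 0.
    apply/matrixP => i k; rewrite !mxE -[RHS](Nw _ (enum_valP i)).
    by rewrite [RHS]big_enum_val /=; apply: eq_bigr => j _; rewrite !mxE.
  have/row_full_inj injN : row_full N by rewrite /row_full rkT.
  have W0 : W = 0 by apply: injN; rewrite NW0 mulmx0.
  move/matrixP/(_ (enum_rank_in v0T v0) 0): W0.
  by rewrite !mxE enum_rankK_in // => /eqP; rewrite (negPf wv0).
have : kermx N != 0 by rewrite -mxrank_eq0 mxrank_ker -lt0n subn_gt0.
case/rowV0Pn => u /sub_kermxP uN /rV0Pn [i0 ui0].
(* Extension of [u] by zero outside [F]: at most one term of the sum is nonzero. *)
pose d (e : E) : K :=
  \sum_(i < #|F|) if enum_val i == e then u 0 i else 0.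
have dE (i : 'I_#|F|) : d (enum_val i) = u 0 i.
  rewrite /d (bigD1 i) //= eqxx big1 ?addr0 // => j ji.
  by rewrite (inj_eq enum_val_inj) (negPf ji).
have dF e : e \notin F -> d e = 0.
  move=> eF; rewrite /d big1 // => i _; case: eqP => // ie.
  by move: eF; rewrite -ie enum_valP.
exists d; split=> //; first by exists (enum_val i0); rewrite dE.
move=> v vT; rewrite (bigID [in F]) /= [X in _ + X]big1 ?addr0; last first.
  by move=> e /dF ->; rewrite mul0r.
rewrite big_enum_val /=.
have /matrixP/(_ 0 (enum_rank_in vT v)) := uN.
rewrite !mxE => uNv; rewrite -[RHS]uNv; apply: eq_bigr => i _.
by rewrite mxE dE enum_rankK_in.
Qed.

(** * Fractional matchings and circulations *)

(** Conditions (1) and (2) for an abstract family [f] of vertex sets; the theorem takes [f] to be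
    [val] on the edges of the neighbor graph. *)
Definition fractional_matching (R : realType) (V E : finType) (S : {set V})
    (f : E -> {set V}) (x : {ffun E -> R^o}) : Prop :=
  (forall e, 0 <= x e :> R) /\
  (forall v, v \in S -> \sum_(e | v \in f e) (x e : R) = 1 :> R).

Definition fractional_edges (R : realType) (E : finType) (x : {ffun E -> R^o}) :
    {set E} :=
  [set e | (x e != 0 :> R) && (x e != 1 :> R)].

(** If [e] were the only fractional edge at [v], the others would have value 0 or 1: a value 1
    pushes the sum at [v] above 1, and all zeros force [x e = 1]. *)
Lemma fractional_degree (R : realType) (V E : finType) (S : {set V})
    (f : E -> {set V}) (x : {ffun E -> R^o}) (e : E) (v : V) :
  fractional_matching S f x -> v \in S -> v \in f e ->
  e \in fractional_edges x ->
  (1 < #|[set i in fractional_edges x | v \in f i]|)%N.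
Proof.
move=> [x0 x1] vS ve eF; rewrite ltnNge; apply/negP => le1.
have others i : v \in f i -> i != e -> x i = 0 :> R \/ x i = 1 :> R.
  move=> vi ie; case: (boolP (i \in fractional_edges x)) => iF; last first.
    by move: iF; rewrite inE negb_and !negbK => /orP[] /eqP; [left|right].
  have : (#|[set i; e]| <= 1)%N.
    apply: leq_trans le1; apply: subset_leq_card; apply/fintype.subsetP => j /set2P[] ->.
      by rewrite inE iF vi.
    by rewrite inE eF ve.
  by rewrite cards2 ie.
move: eF; rewrite inE => /andP[xe0 xe1].
have := x1 v vS; rewrite (bigD1 e) //=.
case: (pickP [pred i | [&& v \in f i, i != e & (x i == 1 :> R)]]) => /=.
  move=> i /and3P[vi ie /eqP xi1]; rewrite (bigD1 i) /= ?vi //.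
  have r0 : 0 <= \sum_(j | (v \in f j) && (j != e) && (j != i)) (x j : R).
    by apply: sumr_ge0.
  move: (x0 e) xe0; rewrite le_eqVlt => /predU1P[<-|xe_gt0 _]; first by rewrite eqxx.
  by rewrite xi1 => H; move: (x0 e) xe_gt0 r0; lra.
move=> none; rewrite big1 ?addr0; first by move=> xe; rewrite xe eqxx in xe1.
move=> i /andP[vi ie]; case: (others i vi ie) => // xi1.
by have := none i; rewrite /= vi ie xi1 eqxx.
Qed.

(** Bipartiteness enters through [c], injective on the vertices of [S] in each edge: it bounds their
    number by two and supplies the signs of the right kernel vector. *)
Lemma fractional_circulation (R : realType) (V E : finType) (S : {set V})
    (f : E -> {set V}) (c : V -> bool) (x : {ffun E -> R^o}) :
  (forall e, f e :&: S != finset.set0) ->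
  (forall e, {in f e :&: S &, injective c}) ->
  fractional_matching S f x -> fractional_edges x != finset.set0 ->
  exists d : E -> R, [/\ exists e, d e != 0, forall e, x e = 0 :> R -> d e = 0
    & forall v, v \in S -> \sum_(e | v \in f e) d e = 0].
Proof.
move=> fS cf xP /set0Pn[e0 e0F].
set F := fractional_edges x in e0F *.
pose T := [set v in S | [exists e in F, v \in f e]].
have cardfT e : (#|f e :&: T| <= 2)%N.
  rewrite -card_bool -(@card_in_imset _ _ c) ?max_card //.
  move=> u v /setIP[ue] /[!inE] /andP[uS _] /andP[ve /andP[vS _]].
  by apply: (cf e); rewrite inE ?ue ?ve.
have double_count :
    (\sum_(e in F) #|f e :&: T| = \sum_(v in T) #|[set e in F | v \in f e]|)%N.
  under eq_bigr do rewrite -sum1_card.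
  under [RHS]eq_bigr do rewrite -sum1_card.
  rewrite (exchange_big_dep [in T]) /=; last by move=> e v _ /setIP[].
  apply: eq_bigr => v vT; apply: eq_bigl => e.
  by rewrite !inE; move: vT; rewrite inE => ->; rewrite andbT.
have ge2 : (\sum_(v in T) 2 <= \sum_(e in F) #|f e :&: T|)%N.
  rewrite double_count; apply: leq_sum => v; rewrite inE => /andP[vS].
  by case/existsP => e /andP[eF ve]; apply: fractional_degree xP vS ve eF.
have le2 : (\sum_(e in F) #|f e :&: T| <= \sum_(e in F) 2)%N by exact: leq_sum.
have [] := @left_kernel_vector R E V (fun e v => (v \in f e)%:R) F T.
- by move: (leq_trans ge2 le2); rewrite !sum_nat_const leq_pmul2r.
- move=> TF; exists (fun v => (-1) ^+ c v); split.
    have /set0Pn[v /setIP[ve vS]] := fS e0.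
    exists v; last by rewrite signr_eq0.
    by rewrite inE vS; apply/existsP; exists e0; rewrite e0F.
  move=> e eF.
  (* When [#|T| = #|F|], the bounds [ge2] and [le2] on the number of incidences coincide, so no edge
     of [F] can meet [T] in fewer than two vertices. *)
  have card2 : #|f e :&: T| = 2%N.
    have eqs : (\sum_(e in F) #|f e :&: T| = \sum_(e in F) 2)%N.
      apply/eqP; rewrite eqn_leq le2 /=; apply: leq_trans ge2.
      by rewrite !sum_nat_const TF.
    apply/eqP; rewrite eqn_leq cardfT /=; rewrite leqNgt; apply/negP => lt2.
    suff : (\sum_(e in F) #|f e :&: T| < \sum_(e in F) 2)%N by rewrite eqs ltnn.
    rewrite (bigD1 e) //= [X in (_ < X)%N](bigD1 e) //= -addSn.
    by apply: leq_add => //; apply: leq_sum.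
  move/eqP/cards2P: card2 => [u [v [uv fTE]]].
  transitivity (\sum_(w in f e :&: T) (-1) ^+ c w : R).
    rewrite [RHS](eq_bigl (fun w => (w \in T) && (w \in f e))); last first.
      by move=> w; rewrite inE andbC.
    rewrite big_mkcondr; apply: eq_bigr => w _.
    by case: (w \in f e); rewrite ?mul1r ?mul0r.
  have : c u != c v.
    apply: contra_neq uv => cuv.
    have : u \in f e :&: T by rewrite fTE !inE eqxx.
    have : v \in f e :&: T by rewrite fTE !inE eqxx orbT.
    move=> /setIP[ve] /[!inE] /andP[vS _] /andP[ue /andP[uS _]].
    by apply: (cf e) cuv; rewrite inE ?ue ?ve.
  rewrite fTE big_setU1 ?inE //= big_set1.
  by case: (c u); case: (c v) => // _; rewrite expr0 expr1 ?subrr // addrC subrr.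
- move=> d [d_neq0 dF dT]; exists d; split=> //.
    by move=> e xe; apply: dF; rewrite inE xe eqxx.
  (* A vertex of [S] outside [T] lies on no edge of [F], so all terms of its sum vanish. *)
  move=> v vS; case: (boolP (v \in T)) => vT.
    rewrite -[RHS](dT v vT) big_mkcond; apply: eq_bigr => e _.
    by case: (v \in f e); rewrite ?mulr1 ?mulr0.
  apply: big1 => e ve; apply: dF; apply: contraNN vT => eF.
  by rewrite inE vS; apply/existsP; exists e; rewrite eF.
Qed.

(** * Splitting a point along a circulation *)

Definition edge_support (R : realType) (E : finType) (x : {ffun E -> R^o}) :
    {set E} :=
  [set e | x e != 0 :> R].

Definition translate (R : realType) (E : finType) (x : {ffun E -> R^o}) (t : R)
    (d : E -> R) : {ffun E -> R^o} :=
  [ffun e => (x e : R) + t * d e].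

(* The step length is the least ratio [x e / - d e] over [d e < 0]. *)
Lemma fractional_matching_step (R : realType) (V E : finType) (S : {set V})
    (f : E -> {set V}) (x : {ffun E -> R^o}) (d : E -> R) :
  fractional_matching S f x ->
  (exists e, d e < 0) -> (forall e, x e = 0 :> R -> d e = 0) ->
  (forall v, v \in S -> \sum_(e | v \in f e) d e = 0) ->
  exists t : R, [/\ 0 < t,
    fractional_matching S f (translate x t d)
    & (#|edge_support (translate x t d)| < #|edge_support x|)%N].
Proof.
move=> [x0 x1] [e0 de0] dx dS.
case: (@arg_minP _ _ _ e0 (fun e => d e < 0) (fun e => (x e : R) / - d e) de0)
  => e de mine.
have xpos : 0 < x e :> R.
  rewrite lt_neqAle x0 andbT eq_sym; apply/eqP => /dx d0.
  by rewrite d0 ltxx in de.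
set t := (x e : R) / - d e.
have t0 : 0 < t by rewrite divr_gt0 // oppr_gt0.
have xte : (x e : R) + t * d e = 0.
  by rewrite /t invrN mulrN mulNr mulfVK ?lt_eqF // subrr.
exists t; split=> //.
- split=> [i|v vS].
    rewrite ffunE; case: (ltP (d i) 0) => di; last first.
      by rewrite addr_ge0 ?x0 // mulr_ge0 // ltW.
    have := mine i di; rewrite -/t ler_pdivlMr ?oppr_gt0 //.
    by rewrite mulrN lerNl -subr_ge0 opprK addrC.
  under eq_bigr do rewrite ffunE.
  by rewrite big_split /= x1 // -mulr_sumr dS // mulr0 addr0.
- apply: proper_card; apply/properP; split.
    apply/fintype.subsetP => i; rewrite !inE ffunE; apply: contra_neq => xi.
    by rewrite dx // xi mulr0 addr0.
  by exists e; rewrite !inE ?ffunE ?xte ?eqxx // gt_eqF.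
Qed.

Lemma fractional_matching_hull (R : realType) (V E : finType) (S : {set V})
    (f : E -> {set V}) (c : V -> bool) (x : {ffun E -> R^o}) :
  (forall e, f e :&: S != finset.set0) ->
  (forall e, {in f e :&: S &, injective c}) ->
  fractional_matching S f x ->
  convex_hull (fun y : {ffun E -> R^o} =>
    fractional_matching S f y /\ fractional_edges y = finset.set0) x.
Proof.
move=> fS cf; have [n] := ubnP #|edge_support x|.
elim: n x => // n IHn x ltn xP.
have [F0|F_neq0] := eqVneq (fractional_edges x) finset.set0.
  by apply: convex_hull_incl.
have [d [[e de] dx dS]] := @fractional_circulation R V E S f c x fS cf xP F_neq0.
have [v /setIP[ve vS]] := set0Pn _ (fS e).
(* A zero sum at [v] with a nonzero term needs a negative term. Applied to both [d] and [- d], this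
   gives a finite step in each direction. *)
have neg (g : E -> R) : g e != 0 -> \sum_(i | v \in f i) g i = 0 ->
    exists i, g i < 0.
  move=> ge gv; case: (pickP [pred i | g i < 0]) => [i gi|g0]; first by exists i.
  have g_ge0 i : 0 <= g i by rewrite leNgt; have /= -> := g0 i.
  have /psumr_eq0P : forall i, v \in f i -> 0 <= g i by [].
  by move=> /(_ gv e ve) ge0; rewrite ge0 eqxx in ge.
have [s [s0 sP lts]] := fractional_matching_step xP (neg d de (dS v vS)) dx dS.
have dNS u : u \in S -> \sum_(i | u \in f i) - d i = 0.
  by move=> uS; rewrite sumrN dS ?oppr0.
have dNx i : x i = 0 :> R -> - d i = 0 by move=> /dx ->; rewrite oppr0.
have dNe : - d e != 0 by rewrite oppr_eq0.
have [t [t0 tP ltt]] :=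
  fractional_matching_step xP (neg (fun i => - d i) dNe (dNS v vS)) dNx dNS.
have st0 : s + t != 0 by rewrite gt_eqF ?addr_gt0.
(* The weights make the displacements [s * d] and [- t * d] cancel. *)
have -> : x = (t / (s + t)) *: translate x s d +
              (s / (s + t)) *: translate x t (fun i => - d i).
  apply/ffunP => i; rewrite !ffunE /GRing.scale /=.
  by field.
apply: convex_hull_conv.
- by rewrite divr_ge0 ?ltW ?addr_gt0.
- by rewrite divr_ge0 ?ltW ?addr_gt0.
- by rewrite -mulrDl addrC mulfV // addrC.
- by apply: IHn => //; apply: leq_trans lts _.
- by apply: IHn => //; apply: leq_trans ltt _.
Qed.

(** * Integral points and the neighbor graph *)

Lemma convex_hull_mono (R : realType) (V : lmodType R) (A B : set V) (x : V) :
  (forall y, A y -> B y) -> convex_hull A x -> convex_hull B x.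
Proof.
move=> AB [n [a [p [a0 a1 Ap ->]]]].
by exists n, a, p; split=> // i; apply: AB.
Qed.

Lemma chi_fractional_matching (R : realType) (G : sgraph) (S : {set G})
    (M : {set {set G}}) :
  S_matching S M ->
  fractional_matching S (fun e : {e : {set G} | e \in nedges S} => val e)
    (chi R S M).
Proof.
move=> [MS Mdisj Mcov]; split=> [e|v vS]; first by rewrite ffunE ler0n.
have [e eM ve] := Mcov v vS.
have eS : e \in nedges S by apply: (fintype.subsetP MS).
rewrite (bigD1 (exist _ e eS)) //= ffunE /= eM big1 ?addr0 //.
move=> i /andP[vi ie]; rewrite ffunE.
case: (boolP (val i \in M)) => //= iM.
by case: (Mdisj _ _ iM eM _ v vS).
Qed.

(** [M] consists of the edges of value 1: two of them at a vertex of [S] would make its sum at least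
    2, and none would make it 0. *)
Lemma integral_matching_chi (R : realType) (G : sgraph) (S : {set G})
    (x : edge_space R S) :
  fractional_matching S (fun e : {e : {set G} | e \in nedges S} => val e) x ->
  fractional_edges x = finset.set0 ->
  exists2 M, S_matching S M & x = chi R S M.
Proof.
move=> [x0 x1] F0.
have x01 e : x e != 0 :> R -> x e = 1 :> R.
  move=> xe; have /setP/(_ e) := F0; rewrite !inE xe /=.
  by move/negbFE/eqP.
pose M : {set {set G}} :=
  [set val e | e : {e : {set G} | e \in nedges S} & (x e == 1 :> R)].
have memM e : (val e \in M) = (x e == 1 :> R).
  by rewrite /M mem_imset ?inE //; apply: val_inj.
exists M.
  split.
  - by apply/fintype.subsetP => _ /imsetP[e _ ->]; apply: valP.
  - move=> _ _ /imsetP[e + ->] /imsetP[i + ->] ei v vS [ve vi].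
    rewrite !inE => /eqP xe /eqP xi.
    have := x1 v vS; rewrite (bigD1 e) //= (bigD1 i) /=; last first.
      by rewrite vi eq_sym; apply: contra_neq ei => ->.
    rewrite xe xi; set r := (X in _ + (_ + X)).
    have : 0 <= r by apply: sumr_ge0.
    by lra.
  - move=> v vS.
    case: (pickP [pred e : {e : {set G} | e \in nedges S} |
                   (v \in val e) && (x e != 0 :> R)]) => [e /andP[ve xe]|none].
      by exists (val e); rewrite // memM x01.
    have := x1 v vS; rewrite big1; first by move/eqP; rewrite eq_sym oner_eq0.
    by move=> e ve; have := none e; rewrite /= ve /= => /negbFE/eqP.
apply/ffunP => e; rewrite ffunE memM.
case: eqP => [//|xe1] /=; apply/eqP; apply: contraT => /x01 xe.
by case: xe1.
Qed.

(** Two distinct vertices of [S] on one edge are its two ends, hence adjacent in the induced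
    subgraph. Outside [S] the colour defaults to [false]. *)
Lemma induced_coloring (G : sgraph) (S : {set G}) :
  bipartite (induced S) ->
  exists c : G -> bool, forall e, e \in edges G -> {in e :&: S &, injective c}.
Proof.
move=> [A AP]; exists (fun v => if insub v is Some u then u \in A else false).
move=> _ /imsetP[[a b] /[!inE] /= ab ->] u v.
rewrite !inE => /andP[ue uS] /andP[ve vS].
rewrite (insubT (fun v => v \in S) uS) (insubT (fun v => v \in S) vS) => cuv.
case: (eqVneq u v) => // uv.
have adj_uv : adj u v.
  case/orP: ue uv => /eqP ->; case/orP: ve => /eqP -> //; rewrite ?eqxx //.
  by rewrite adj_sym.
by have := AP (Sub u uS) (Sub v vS) adj_uv; rewrite cuv eqxx.
Qed.

Theorem theorem3p3 (R : realType) (G : sgraph) (S : {set G})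
    (hS : bipartite (induced S)) (x : edge_space R S) :
  S_matching_polytope x <->
  (forall e : {e : {set G} | e \in nedges S}, 0 <= x e :> R) /\
  (forall v : G, v \in S ->
     \sum_(e : {e : {set G} | e \in nedges S} | v \in val e) (x e : R) = 1 :> R).
Proof.
split.
  (* Both conditions hold at each [chi R S M] and pass to convex combinations by linearity. *)
  move=> [n [a [p [a0 a1 pM ->]]]].
  have pP i : fractional_matching S
      (fun e : {e : {set G} | e \in nedges S} => val e) (p i).
    by have [M MS ->] := pM i; apply: chi_fractional_matching.
  have sumE e : (\sum_i a i *: p i) e = \sum_i a i * (p i e : R) :> R.
    by rewrite sum_ffunE; apply: eq_bigr => i _; rewrite ffunE.
  split=> [e|v vS].
    by rewrite sumE; apply: sumr_ge0 => i _; rewrite mulr_ge0 //; case: (pP i).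
  under eq_bigr do rewrite sumE.
  rewrite exchange_big /= -[RHS]a1; apply: eq_bigr => i _.
  by rewrite -mulr_sumr; case: (pP i) => _ ->; rewrite ?mulr1.
move=> xP; have [c cP] := @induced_coloring G S hS.
apply: convex_hull_mono (@fractional_matching_hull R G
  {e : {set G} | e \in nedges S} S (fun e => val e) c x _ _ xP).
- by move=> y [yP yF]; apply: integral_matching_chi.
- move=> e; have := valP e; rewrite /= inE => /andP[_ /existsP[v /andP[vS ve]]].
  by apply/set0Pn; exists v; rewrite inE ve.
- by move=> e; apply: cP; have := valP e; rewrite /= inE => /andP[].
Qed.
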